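(* For every real $R>0$, $$c_1 R^2 - c_2 R \;\leq\; \#\left\{ \Gamma \in \mathcal{C}_2 : \lambda_2(\Gamma) \leq R,\ \Gamma \text{ is } \mathrm{WR}' \right\} \;\leq\; c_3 R^2 + c_4 R,$$ where $c_1=\frac{4\sqrt{2+\sqrt3}-3-\sqrt3}{8+4\sqrt3}=0.200650\ldots$, $c_2=\frac{5+\sqrt3+4\sqrt{2+\sqrt3}}{2\sqrt{2+\sqrt3}}-\frac{1}{\sqrt2}=3.035275\ldots$, $c_3=\frac{1}{\sqrt{2+\sqrt3}}-\frac14=0.267638\ldots$, and $c_4=\frac{\sqrt{2+\sqrt3}}{2}+\frac{1}{\sqrt2}=1.673031\ldots$.
   Context: Let $\operatorname{rot}(x_1,x_2)=(x_2,x_1)$ on $\mathbb{R}^2$. A sublattice $\Gamma\subseteq\mathbb{Z}^2$ is cyclic if $\operatorname{rot}(\Gamma)=\Gamma$; $\mathcal{C}_2$ is the set of full-rank cyclic sublattices of $\mathbb{Z}^2$. $\lambda_1(\Gamma)\le\lambda_2(\Gamma)$ are the successive minima with respect to the Euclidean norm, $S(\Gamma)$ is the set of vectors of $\Gamma$ of norm $\lambda_1(\Gamma)$, and $\Gamma$ is $\mathrm{WR}'$ if $\Gamma=\operatorname{span}_{\mathbb{Z}}S(\Gamma)$. *)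

(* Defs.v *)
From HB Require Import structures.
From mathcomp Require Import all_boot all_order all_algebra finmap.
From mathcomp Require Import all_classical all_reals.

Set Implicit Arguments.
Unset Strict Implicit.
Unset Printing Implicit Defensive.

Import Order.TTheory GRing.Theory Num.Theory.

Local Open Scope classical_set_scope.
Local Open Scope ring_scope.

(* Vectors of Z^2 are integer row vectors, and a subset of Z^2 is a
   [set 'rV[int]_2]; the real field K only enters through norms and linear
   independence over the reals. *)

Definition rotv (x : 'rV[int]_2) : 'rV[int]_2 := xcol 0 1 x.

Definition enorm (K : realType) (n : nat) (x : 'rV[K]_n) : K :=
  Num.sqrt (\sum_(j < n) x 0 j ^+ 2).

Definition toK (K : realType) (m n : nat) (M : 'M[int]_(m, n)) : 'M[K]_(m, n) :=
  map_mx intr M.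

(* The rows of M are i vectors of Gamma that are linearly independent over K. *)
Definition indep_in (K : realType) (i : nat) (Gamma : set 'rV[int]_2)
    (M : 'M[int]_(i, 2)) : Prop :=
  (forall k : 'I_i, Gamma (row k M)) /\ row_free (toK K M).

Definition sublattice (Gamma : set 'rV[int]_2) : Prop :=
  zmod_closed (mem Gamma).

Definition full_rank (K : realType) (Gamma : set 'rV[int]_2) : Prop :=
  exists M : 'M[int]_2, indep_in K Gamma M.

Definition cyclic_lattice (Gamma : set 'rV[int]_2) : Prop :=
  rotv @` Gamma = Gamma.

Definition C2 (K : realType) : set (set 'rV[int]_2) :=
  [set Gamma | [/\ sublattice Gamma, full_rank K Gamma & cyclic_lattice Gamma]].

(* i-th successive minimum: the infimum of the radii r such that the closed
   Euclidean ball of radius r contains i linearly independent vectors of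
   Gamma. *)
Definition succ_min (K : realType) (i : nat) (Gamma : set 'rV[int]_2) : K :=
  inf [set r : K | 0 <= r /\
    exists M : 'M[int]_(i, 2), indep_in K Gamma M /\
      forall k : 'I_i, enorm (toK K (row k M)) <= r].

Definition min_vectors (K : realType) (Gamma : set 'rV[int]_2) :
    set 'rV[int]_2 :=
  [set x | Gamma x /\ enorm (toK K x) = succ_min K 1 Gamma].

Definition Zspan (S : set 'rV[int]_2) : set 'rV[int]_2 :=
  [set x | exists (n : nat) (v : 'I_n -> 'rV[int]_2) (c : 'I_n -> int),
    (forall k, S (v k)) /\ x = \sum_(k < n) c k *: v k].

Definition WR' (K : realType) (Gamma : set 'rV[int]_2) : Prop :=
  Gamma = Zspan (min_vectors K Gamma).

Definition C2_WR' (K : realType) (R : K) : set (set 'rV[int]_2) :=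
  [set Gamma | [/\ C2 K Gamma, succ_min K 2 Gamma <= R & WR' K Gamma]].

Definition c1 (K : realType) : K :=
  (4 * Num.sqrt (2 + Num.sqrt 3) - 3 - Num.sqrt 3) / (8 + 4 * Num.sqrt 3).

Definition c2 (K : realType) : K :=
  (5 + Num.sqrt 3 + 4 * Num.sqrt (2 + Num.sqrt 3))
    / (2 * Num.sqrt (2 + Num.sqrt 3)) - 1 / Num.sqrt 2.

Definition c3 (K : realType) : K :=
  1 / Num.sqrt (2 + Num.sqrt 3) - 1 / 4.

Definition c4 (K : realType) : K :=
  Num.sqrt (2 + Num.sqrt 3) / 2 + 1 / Num.sqrt 2.

(* Main.v *)
(* If a cyclic lattice is generated by its minimal vectors, either all of these
   lie on the two diagonals, and the lattice is spanned by (a,a) and (a,-a), or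
   one of them can be moved by sign changes and rot to (a,b) with a > |b|, and
   then the lattice is spanned by (a,b) and (b,a).  Minimality of (a,b) against
   (a,b) +- (b,a) means 4 a |b| <= a^2 + b^2, an equality being impossible by
   irrationality of sqrt 3: (a,b) lies strictly within 15 degrees of the
   horizontal axis, and it is determined by the lattice.
   Counting: for the upper bound, the row |b| = m >= 1 contains at most
   R + 1 - (2 + sqrt 3) m points, and is empty unless
   m <= R / (2 sqrt (2 + sqrt 3)).  For the lower bound, the lattices with
   |b| <= a / 4 and a <= 9 R / 10 suffice. *)
Require Import Defs.
From mathcomp Require Import all_boot all_order all_algebra finmap.
From mathcomp Require Import all_classical all_reals.
From mathcomp Require Import perm zify ring lra.
Import Order.TTheory GRing.Theory Num.Theory.
Local Open Scope classical_set_scope.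
Local Open Scope ring_scope.

Set Implicit Arguments.
Unset Strict Implicit.
Unset Printing Implicit Defensive.

(** * Integer inequalities for angles of 15 and 60 degrees *)

(** Equality would give [(a - 2 * p) ^+ 2 = 3 * p ^+ 2], where the exponent of 3 is even on the left
    and odd on the right. *)
Lemma mul4_neq_sum_sqr (a p : int) : 0 < a -> 4 * a * p <> a ^+ 2 + p ^+ 2.
Proof.
move=> a0 e.
have p0 : `|p|%N != 0%N.
  by rewrite absz_eq0; apply/eqP=> p0; move: e; rewrite p0; nia.
have e2 : (absz (a - 2 * p)%R ^ 2 = 3 * absz p ^ 2)%N.
  have : (a - 2 * p) ^+ 2 = 3 * p ^+ 2 by rewrite sqrrB; nia.
  by move=> h; rewrite -!abszX h abszM.
have q0 : (0 < absz (a - 2 * p)%R)%N.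
  by case: (absz _) e2 p0 => // ; case: (absz p).
have := congr1 (logn 3) e2.
rewrite lognX lognM ?expn_gt0 ?lt0n ?p0 // lognX (_ : logn 3 3 = 1%N) //.
lia.
Qed.

(* A vector within 15 degrees of the horizontal axis and one within 45 degrees
   make an angle below 60 degrees. *)
Lemma sqr_dist_lt (a b c d : int) : `|b| < a -> `|d| <= c ->
  4 * a * `|b| < a ^+ 2 + b ^+ 2 -> c ^+ 2 + d ^+ 2 = a ^+ 2 + b ^+ 2 ->
  (c - a) ^+ 2 + (d - b) ^+ 2 < a ^+ 2 + b ^+ 2.
Proof.
move=> ba dc ab e.
have eb : b ^+ 2 = `|b| ^+ 2 by rewrite -normrX ger0_norm ?sqr_ge0.
have ed : d ^+ 2 = `|d| ^+ 2 by rewrite -normrX ger0_norm ?sqr_ge0.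
have bd : - (`|b| * `|d|) <= b * d by rewrite -normrM lerNl -normrN ler_norm.
have b0 := normr_ge0 b; have d0 := normr_ge0 d.
(* As both vectors have the same squared norm, a short difference means an inner product above half
   of it. *)
suff : a ^+ 2 + b ^+ 2 < 2 * (a * c + b * d) by nra.
rewrite eb ed in e ab *; set p := `|b| in e ab ba bd b0 *; set q := `|d| in e dc bd d0.
(* The worst case is [d] of size [c] and of sign opposite to [b], where (c, d) lies on a
   diagonal. *)
have h : c * (a - p) <= a * c + b * d by nra.
suff : a ^+ 2 + p ^+ 2 < 2 * (c * (a - p)) by nra.
have c0 : 0 < c.
  rewrite lt_neqAle (le_trans d0 dc) andbT; apply/eqP => c0.
  have q0 : q = 0 by apply/eqP; rewrite eq_le d0 c0 dc.
  suff : 0 < a ^+ 2 + p ^+ 2 by rewrite -e -c0 q0 ltxx.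
  by rewrite ltr_wpDr ?sqr_ge0 ?exprn_gt0 // (le_lt_trans b0).
have ap : 0 < a - p by rewrite subr_gt0.
(* After squaring, the bound is the product of [h1], which says that (c, d) is within 45 degrees of
   the axis, and [h2], a rewriting of the 15 degree condition [ab]. *)
rewrite -ltr_sqr ?nnegrE; last 2 first.
- by rewrite addr_ge0 ?sqr_ge0.
- by rewrite !mulr_ge0 // ltW.
have h1 : a ^+ 2 + p ^+ 2 <= 2 * c ^+ 2.
  by rewrite -e mulr_natl mulr2n lerD2l ler_sqr ?nnegrE // ltW.
have h2 : a ^+ 2 + p ^+ 2 < 2 * (a - p) ^+ 2.
  by rewrite sqrrB; clear -ab; lia.
have h3 : 0 < a ^+ 2 + p ^+ 2 by rewrite ltr_wpDr ?sqr_ge0 ?exprn_gt0 // (le_lt_trans b0).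
rewrite expr2 [ltRHS](_ : _ = (2 * c ^+ 2) * (2 * (a - p) ^+ 2)); last by ring.
apply: (@le_lt_trans _ _ (2 * c ^+ 2 * (a ^+ 2 + p ^+ 2))).
  by rewrite ler_wpM2r // ltW.
by rewrite ltr_pM2l // (lt_le_trans h3).
Qed.

(** * Numerical estimates behind the four constants *)

Section Num.
Variable K : realType.
(* k = cot 15 degrees and s = 2 cos 15 degrees. *)
Notation k := (2 + Num.sqrt 3 : K).
Notation s := (Num.sqrt k).

Lemma sqrt3_bounds : 173 / 100 < (Num.sqrt 3 : K) < 174 / 100.
Proof.
have e : Num.sqrt 3 ^+ 2 = 3 :> K by rewrite sqr_sqrtr.
have := sqrtr_ge0 (3 : K); move: e; set t := Num.sqrt 3 => e t0.
by apply/andP; split; nra.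
Qed.

Lemma sqr_two_cos15 : s ^+ 2 = k.
Proof. by rewrite sqr_sqrtr // addr_ge0 ?sqrtr_ge0. Qed.

Lemma two_cos15_bounds : 193 / 100 < (s : K) < 194 / 100.
Proof.
have := sqrt3_bounds; have := sqr_two_cos15; have := sqrtr_ge0 k.
move=> ? ? /andP[? ?]; apply/andP; split; nra.
Qed.
(* With k = s^2 and q = R / (2 s), the right-hand side is 2 q R - k q^2 + k q. *)
Lemma upper_count_bound (R B : K) : 1 <= R -> 0 <= B -> B <= R / (2 * s) ->
  R + 2 * B * (R + 1) - k * B * (B + 1) <= (1 / s - 1 / 4) * R ^+ 2 + s / 2 * R.
Proof.
move=> R1 B0 Bq.
move: two_cos15_bounds sqr_two_cos15 Bq; move: (Num.sqrt (2 + Num.sqrt 3 : K)) => s.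
have /andP[t1 t2] := sqrt3_bounds => /andP[s1 s2] es Bq.
rewrite -es; set q := R / (2 * s) in Bq.
have sn0 : s != 0 by lra.
have eR : R = 2 * s * q by rewrite /q; field.
rewrite eR [X in _ <= X * _ + _](_ : _ = (4 - s) / (4 * s)); last by field; lra.
rewrite [leRHS](_ : _ = (4 - s) * s * q ^+ 2 + s ^+ 2 * q); last by field; lra.
have q1 : 1 / 4 <= q by nra.
(* In terms of [D], the right-hand side minus the left-hand side is the quantity in [h2], minus the
   one in [h4], minus the one in [h5]; the bounds add up to at least 0.395 - 0.22. *)
clearbody q; set D := q - B; have -> : B = q - D by rewrite /D; ring.
have D0 : 0 <= D by rewrite /D; lra.
have h1 : 0 <= 4 * s - 2 * s ^+ 2 by rewrite es; nra.
have h2 : 0 <= D * (q * (4 * s - 2 * s ^+ 2)) by apply/mulr_ge0/mulr_ge0 => //; lra.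
have h3 : 2 * s + 2 - 2 * s ^+ 2 <= - (158/100) by rewrite es; lra.
have h4 : (s ^+ 2 - 2) * D - s ^+ 2 * D ^+ 2 <= 22/100.
  have : 373 / 100 * D ^+ 2 <= s ^+ 2 * D ^+ 2 by rewrite ler_wpM2r ?sqr_ge0 // es; lra.
  have : (s ^+ 2 - 2) * D <= 174 / 100 * D by rewrite ler_wpM2r // es; lra.
  (* The parabola [174 / 100 * D - 373 / 100 * D ^+ 2] has its vertex near 0.233, with a value below
     0.21. *)
  have := sqr_ge0 (D - 233/1000); nra.
have h5 : q * (2 * s + 2 - 2 * s ^+ 2) <= - (158/100) / 4 by nra.
rewrite -subr_ge0.
nra.
Qed.

(** Rough bounds on [c1] and [c2] suffice: [n] is at least A (A - 1) / 4 with A > 9 R / 10 - 1, and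
    the leading coefficient 81 / 400 = 0.2025 exceeds [c1]. *)
Lemma lower_count_bound (R : K) (A n : nat) : 0 < R -> 9 * R / 10 < A.+1%:R ->
  (A ^ 2 <= 4 * n + A)%N -> c1 K * R ^+ 2 - c2 K * R <= n%:R.
Proof.
move=> R0 RA nA.
have /andP[s1 s2] := two_cos15_bounds; have es := sqr_two_cos15; have /andP[t1 t2] := sqrt3_bounds.
have c1le : c1 K <= 202 / 1000.
  rewrite /c1 ler_pdivrMr; last by lra.
  nra.
have c2ge : 3 <= c2 K.
  rewrite /c2.
  have e : Num.sqrt 2 ^+ 2 = 2 :> K by rewrite sqr_sqrtr.
  have w1 : 141/100 < Num.sqrt 2 :> K by have := sqrtr_ge0 (2 : K); nra.
  have w2 : 1 / Num.sqrt 2 <= 100 / 141 :> K.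
    rewrite ler_pdivrMr; lra.
  suff : 3 + 100 / 141 <= (5 + Num.sqrt 3 + 4 * s) / (2 * s) by lra.
  rewrite ler_pdivlMr; nra.
have nA' : (A%:R : K) ^+ 2 <= 4 * n%:R + A%:R.
  by rewrite -natrX -natrM -natrD ler_nat.
have A0 : 0 <= A%:R :> K by [].
have n0 : 0 <= n%:R :> K by [].
rewrite -natr1 in RA.
apply: (@le_trans _ _ (202 / 1000 * R ^+ 2 - 3 * R)).
  by rewrite lerB // ler_wpM2r // ?sqr_ge0 // ltW.
(* For [R <= 2] the lower bound is at most 0. Beyond that, [A] is at least 1, so that A (A - 1) can
   be bounded below through [RA]. *)
case: (lerP R 2) => R2; first by nra.
suff : (9 * R / 10 - 1) * (9 * R / 10 - 2) <= A%:R * (A%:R - 1) :> K by nra.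
case: (lerP 1 (A%:R : K)) => A1; first nra.
have : (A%:R < 1%:R :> K) by []. rewrite ltr_nat ltnS leqn0 => /eqP A00.
rewrite A00 in RA; lra.
Qed.

(** The roots of t^2 - 4 t + 1 are 2 - sqrt 3 and [k], so a / m, being at least 1, is at least [k].
    Then R^2 >= (k^2 + 1) m^2, and k^2 + 1 = 4 k = (2 s)^2. *)
Lemma row_bound (a m : nat) (R : K) : (m <= a)%N -> (4 * a * m <= a ^ 2 + m ^ 2)%N ->
   (a ^ 2 + m ^ 2)%:R <= R ^+ 2 -> 0 < R -> k * m%:R <= a%:R /\ m%:R <= R / (2 * s).
Proof.
move=> ma am aR R0.
have /andP[s1 s2] := two_cos15_bounds; have es := sqr_two_cos15; have /andP[t1 t2] := sqrt3_bounds.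
have e3 : Num.sqrt 3 ^+ 2 = 3 :> K by rewrite sqr_sqrtr.
have ma' : m%:R <= a%:R :> K by rewrite ler_nat.
have am' : 4 * a%:R * m%:R <= a%:R ^+ 2 + m%:R ^+ 2 :> K.
  by rewrite -!natrX -!natrM -natrD ler_nat.
have m0 : 0 <= m%:R :> K by [].
rewrite natrD !natrX in aR.
have h : k * m%:R <= a%:R.
  case: (lerP (2 * m%:R) (a%:R : K)) => h; last by nra.
  rewrite mulrDl -lerBrDl -ler_sqr ?nnegrE; [|nra|nra].
  rewrite exprMn e3; nra.
split => //.
rewrite ler_pdivlMr; last by nra.
rewrite -ler_sqr ?nnegrE; [|nra|nra].
apply: le_trans aR; rewrite !exprMn es.
have : (k * m%:R) ^+ 2 <= a%:R ^+ 2 by rewrite ler_sqr ?nnegrE //; nra.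
nra.
Qed.
End Num.

(** * Integer vectors, squared norms and lattices with two generators *)

Definition vec2 (a b : int) : 'rV[int]_2 := \row_j (if j == 0 then a else b).

(** Squared norms stay in the integers, which turns every comparison of lengths into integer
    arithmetic. *)
Definition nrm2 (x : 'rV[int]_2) : int := x 0 0 ^+ 2 + x 0 1 ^+ 2.

Definition lat (u v : 'rV[int]_2) : set 'rV[int]_2 :=
  [set z | exists m n : int, z = m *: u + n *: v].

Definition swap_lat (a b : int) := lat (vec2 a b) (vec2 b a).

Definition diag_lat (a : int) := lat (vec2 a a) (vec2 a (- a)).

Lemma vec2_0 a b : vec2 a b 0 0 = a. Proof. by rewrite mxE. Qed.

Lemma vec2_1 a b : vec2 a b 0 1 = b. Proof. by rewrite mxE. Qed.

Definition vec2E := (vec2_0, vec2_1).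

Lemma rv2P (x y : 'rV[int]_2) : x 0 0 = y 0 0 -> x 0 1 = y 0 1 -> x = y.
Proof.
move=> h0 h1; apply/rowP => -[[|[|//]] hj].
  by rewrite (_ : Ordinal hj = 0) //; apply: val_inj.
by rewrite (_ : Ordinal hj = 1) //; apply: val_inj.
Qed.

Lemma sum_ord2 (V : zmodType) (F : 'I_2 -> V) : \sum_(j < 2) F j = F 0 + F 1.
Proof.
by rewrite !big_ord_recl big_ord0 addr0; congr (_ + F _); apply: val_inj.
Qed.

Lemma rotv0 x : rotv x 0 0 = x 0 1. Proof. by rewrite mxE tpermL. Qed.

Lemma rotv1 x : rotv x 0 1 = x 0 0. Proof. by rewrite mxE tpermR. Qed.

Lemma nrm2_rotv x : nrm2 (rotv x) = nrm2 x.
Proof. by rewrite /nrm2 rotv0 rotv1 addrC. Qed.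

Lemma nrm2N x : nrm2 (- x) = nrm2 x.
Proof. by rewrite /nrm2 !mxE !sqrrN. Qed.

Lemma nrm2_ge0 x : 0 <= nrm2 x.
Proof. by rewrite addr_ge0 ?sqr_ge0. Qed.

Lemma enormE (K : realType) x : enorm (toK K x) = Num.sqrt (nrm2 x)%:~R.
Proof. by rewrite /enorm sum_ord2 !mxE intrD !rmorphXn. Qed.

Lemma enorm_le (K : realType) x y :
  (enorm (toK K x) <= enorm (toK K y)) = (nrm2 x <= nrm2 y).
Proof. by rewrite !enormE ler_sqrt ?ler0z ?nrm2_ge0 // ler_int. Qed.

Lemma enorm_eq (K : realType) x y :
  enorm (toK K x) = enorm (toK K y) <-> nrm2 x = nrm2 y.
Proof.
split=> [/eqP|]; last by rewrite !enormE => ->.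
by rewrite eq_le !enorm_le -eq_le => /eqP.
Qed.

Lemma enorm_le_real (K : realType) x (R : K) : 0 <= R ->
  (enorm (toK K x) <= R) = ((nrm2 x)%:~R <= R ^+ 2).
Proof.
by move=> R0; rewrite -{1}(ger0_norm R0) -sqrtr_sqr enormE ler_sqrt // sqr_ge0.
Qed.

Section Sublattice.
Variable G : set 'rV[int]_2.
Hypothesis subG : sublattice G.

Lemma sublattice0 : G 0.
Proof. by case: subG; rewrite inE. Qed.

Lemma sublatticeB u v : G u -> G v -> G (u - v).
Proof. by move=> Gu Gv; have [_ /(_ u v)] := subG; rewrite !inE; apply. Qed.

Lemma sublatticeN u : G u -> G (- u).
Proof. by rewrite -sub0r; apply: sublatticeB; apply: sublattice0. Qed.

Lemma sublatticeD u v : G u -> G v -> G (u + v).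
Proof. by move=> Gu Gv; rewrite -(opprK v); apply/sublatticeB/sublatticeN. Qed.

Lemma sublatticeZ (n : int) u : G u -> G (n *: u).
Proof.
move=> Gu; have Gn (m : nat) : G (m%:Z *: u).
  elim: m => [|m IH]; first by rewrite scale0r; apply: sublattice0.
  by rewrite intS scalerDl scale1r; apply: sublatticeD.
by case: n => m; rewrite ?NegzE ?scaleNr; [|apply: sublatticeN]; apply: Gn.
Qed.

Lemma Zspan_sub (S : set 'rV[int]_2) : S `<=` G -> Zspan S `<=` G.
Proof.
move=> SG x [n [v [c [Sv ->]]]].
by elim/big_ind: _ => // [|u w Gu Gw|i _];
  [apply: sublattice0|apply: sublatticeD|apply/sublatticeZ/SG].
Qed.

Lemma lat_sub u v : G u -> G v -> lat u v `<=` G.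
Proof.
by move=> Gu Gv x [m [n ->]]; apply: sublatticeD; apply: sublatticeZ.
Qed.

End Sublattice.

Lemma lat_sublattice u v : sublattice (lat u v).
Proof.
split; first by rewrite inE; exists 0, 0; rewrite !scale0r addr0.
move=> x y; rewrite !inE => -[m [n ->]] [m' [n' ->]].
by exists (m - m'), (n - n'); rewrite !scalerBl opprD addrACA.
Qed.

Lemma lat_l u v : lat u v u.
Proof. by exists 1, 0; rewrite scale1r scale0r addr0. Qed.

Lemma lat_r u v : lat u v v.
Proof. by exists 0, 1; rewrite scale1r scale0r add0r. Qed.

Lemma lat_sub_Zspan (S : set 'rV[int]_2) u v : S u -> S v -> lat u v `<=` Zspan S.
Proof.
move=> Su Sv x [m [n ->]].
exists 2%N, (fun i => if i == 0 then u else v), (fun i => if i == 0 then m else n).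
split; first by move=> i; case: ifP.
by rewrite sum_ord2.
Qed.

(** * First successive minimum and full rank *)

Section Minima.
Variables (K : realType) (G : set 'rV[int]_2).

Lemma indep1P (z : 'rV[int]_2) : indep_in K G z <-> G z /\ z != 0.
Proof.
have rf : row_free (toK K z) = (z != 0).
  rewrite /row_free rank_rV; suff -> : (toK K z == 0) = (z == 0) by case: (z == 0).
  apply/eqP/eqP => [/rowP e|->]; apply/rowP => j; last by rewrite !mxE.
  by move: (e j); rewrite !mxE => /eqP; rewrite intr_eq0 => /eqP.
rewrite /indep_in rf; have r k : row k z = z by rewrite (ord1 k) row_id.
by split=> [[/(_ 0)]|[Gz z0]]; [rewrite r|split=> // k; rewrite r].
Qed.

Lemma succ_min1_le z : G z -> z != 0 -> succ_min K 1 G <= enorm (toK K z).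
Proof.
move=> Gz z0; apply: ge_inf; first by exists 0 => r [].
split; first exact: sqrtr_ge0.
exists z; split; first exact/indep1P.
by move=> k; rewrite (ord1 k) row_id.
Qed.

Lemma succ_min1_eq x : G x -> x != 0 ->
  (forall z, G z -> z != 0 -> nrm2 x <= nrm2 z) -> succ_min K 1 G = enorm (toK K x).
Proof.
move=> Gx x0 minx; apply/eqP; rewrite eq_le succ_min1_le //=.
apply: lb_le_inf.
  exists (enorm (toK K x)); split; first exact: sqrtr_ge0.
  exists x; split; first exact/indep1P.
  by move=> k; rewrite (ord1 k) row_id.
move=> r [_ [M [/indep1P[GM M0] /(_ 0)]]]; rewrite row_id; apply: le_trans.
by rewrite enorm_le; apply: minx.
Qed.

Lemma indep_row_neq0 (M : 'M[int]_2) i : row_free (toK K M) -> row i M != 0.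
Proof.
move=> /row_freeP[B MB]; apply/eqP => r0.
have : row i (toK K M *m B) = 0.
  by rewrite row_mul /toK -map_row r0 map_mx0 mul0mx.
by rewrite MB => /rowP/(_ i); rewrite !mxE eqxx => /eqP; rewrite oner_eq0.
Qed.

(** Otherwise the invertible matrix of two independent vectors of [G] would send the nonzero column
    (p, q) to 0. *)
Lemma full_rank_form (p q : int) : full_rank K G -> (p != 0) || (q != 0) ->
  exists2 z, G z & p * z 0 0 + q * z 0 1 != 0.
Proof.
move=> [M [GM rfM]] pq; apply: contrapT => H.
have {}H i : p * M i 0 + q * M i 1 = 0.
  apply/eqP/negP => h; apply: H; exists (row i M) => //.
  by apply/negP; rewrite !mxE.
have : toK K M *m (toK K (vec2 p q))^T = 0.
  apply/colP => i; rewrite !mxE sum_ord2 !mxE /=.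
  have := congr1 (fun x : int => x%:~R : K) (H i).
  by rewrite intrD !intrM mulrC [_%:~R * (M i 1)%:~R]mulrC.
move: rfM; rewrite row_free_unit => uM /(congr1 (mulmx (invmx (toK K M)))).
rewrite mulKmx // mulmx0 => /colP e.
have := e 0; have := e 1; rewrite !mxE /= => /eqP; rewrite intr_eq0 => /eqP q0.
by move/eqP; rewrite intr_eq0 => /eqP p0; move: pq; rewrite p0 q0 eqxx.
Qed.

End Minima.

(** * Reduced generators and the lattices they span *)

(** If t is the angle of (a, b) to the horizontal axis, the second condition says sin (2 |t|) < 1/2;
    the first one then selects |t| < 15 degrees. *)
Definition reduced (a b : int) :=
  `|b| < a /\ 4 * a * `|b| < a ^+ 2 + b ^+ 2.

Lemma nrm2_vec2 a b : nrm2 (vec2 a b) = a ^+ 2 + b ^+ 2.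
Proof. by rewrite /nrm2 !vec2E. Qed.

Lemma rotv_vec2 a b : rotv (vec2 a b) = vec2 b a.
Proof. by apply: rv2P; rewrite ?rotv0 ?rotv1 !vec2E. Qed.

Lemma rotvK : involutive rotv.
Proof. by move=> x; apply: rv2P; rewrite ?(rotv0, rotv1). Qed.

Section MinVectors.
Variables (K : realType) (G : set 'rV[int]_2).

Lemma min_vectors_le x z : min_vectors K G x -> G z -> z != 0 -> nrm2 x <= nrm2 z.
Proof. by move=> [_ ex] Gz z0; rewrite -(enorm_le K) ex; apply: succ_min1_le. Qed.

Lemma min_vectors_eq x z : min_vectors K G x ->
  min_vectors K G z <-> G z /\ nrm2 z = nrm2 x.
Proof.
move=> [_ ex]; split=> [[Gz ez]|[Gz /(enorm_eq K) ez]]; split=> //.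
  by apply/(enorm_eq K); rewrite ez.
by rewrite ez.
Qed.

Hypothesis subG : sublattice G.

(** Two distinct such vectors would be less than 60 degrees apart, and by [sqr_dist_lt] their
    difference would be shorter than a minimal vector. *)
Lemma reduced_min_vector a b z : reduced a b -> min_vectors K G (vec2 a b) ->
  min_vectors K G z -> `|z 0 1| <= z 0 0 -> z = vec2 a b.
Proof.
move=> [ba ab] Sx /(min_vectors_eq z Sx)[Gz ez] zc; have [Gx _] := Sx.
apply/eqP; rewrite -subr_eq0; apply/negP => /negP.
move=> /(min_vectors_le Sx (sublatticeB subG Gz Gx)).
rewrite nrm2_vec2 /nrm2 !mxE /= leNgt => /negP; apply; apply: sqr_dist_lt => //.
exact: etrans ez (nrm2_vec2 a b).
Qed.

End MinVectors.

(** With N = a^2 + b^2, the squared norm of m (a, b) + n (b, a) is (m^2 + n^2) N + 4 a b m n.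
    Reducedness bounds the cross term by |m n| N, and m^2 + n^2 - |m n| is a positive integer. *)
Lemma swap_lat_min a b z : reduced a b -> swap_lat a b z -> z != 0 ->
  a ^+ 2 + b ^+ 2 <= nrm2 z.
Proof.
move=> [ba ab] [m [n ez]] z0.
have mn : (m != 0) || (n != 0).
  by move: z0; apply: contraNT; rewrite negb_or !negbK ez => /andP[/eqP-> /eqP->];
    rewrite !scale0r addr0.
rewrite /nrm2 ez !mxE /=; set N := a ^+ 2 + b ^+ 2 in ab *.
rewrite [leRHS](_ : _ = (m ^+ 2 + n ^+ 2) * N + 4 * a * (m * n * b)); last by rewrite /N; ring.
have h1 : - (`|m * n| * N) <= 4 * a * (m * n * b).
  rewrite lerNl; apply: (@le_trans _ _ (`|m * n| * (4 * a * `|b|))).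
    apply: (le_trans (ler_norm _)); rewrite normrN !normrM.
    by rewrite [ `|a|]ger0_norm; [nia|apply: le_trans (ltW ba)].
  by rewrite ler_wpM2l // ltW.
have N0 : 0 <= N by rewrite addr_ge0 ?sqr_ge0.
have h2 : 1 <= m ^+ 2 + n ^+ 2 - `|m * n|.
  rewrite normrM; clear -mn; nia.
have h3 : 1 * N <= (m ^+ 2 + n ^+ 2 - `|m * n|) * N by rewrite ler_wpM2r.
by rewrite mulrBl in h3; lra.
Qed.

Lemma swap_lat_min_vector (K : realType) a b : reduced a b ->
  min_vectors K (swap_lat a b) (vec2 a b).
Proof.
move=> r; split; first exact: lat_l.
apply/esym/succ_min1_eq; first exact: lat_l.
  apply/eqP => /rowP/(_ 0); rewrite !mxE /= => a0; case: r => [+ _].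
  by rewrite a0 ltNge normr_ge0.
by move=> z Gz z0; rewrite nrm2_vec2; apply: swap_lat_min.
Qed.

(** Both generators are minimal vectors of the same lattice, and [reduced_min_vector] leaves only
    one in the sector around the positive axis. *)
Lemma swap_lat_inj (K : realType) a b c d : reduced a b -> reduced c d ->
  swap_lat a b = swap_lat c d -> a = c /\ b = d.
Proof.
move=> rab rcd e.
have Sx := swap_lat_min_vector K rab; have Sz := swap_lat_min_vector K rcd.
have ez : vec2 c d = vec2 a b.
  apply: (reduced_min_vector (lat_sublattice _ _) rab Sx).
    by rewrite -/(swap_lat a b) e.
  by rewrite !vec2E ltW //; case: rcd.
by split; [rewrite -(vec2_0 a b) -ez vec2E|rewrite -(vec2_1 a b) -ez vec2E].
Qed.

Lemma rotvD x y : rotv (x + y) = rotv x + rotv y.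
Proof. by apply: rv2P; rewrite ?(rotv0, rotv1) !mxE ?(tpermL, tpermR). Qed.

Lemma rotvZ (m : int) x : rotv (m *: x) = m *: rotv x.
Proof. by apply: rv2P; rewrite ?(rotv0, rotv1) !mxE ?(tpermL, tpermR). Qed.

Lemma swap_lat_rotv a b z : swap_lat a b z -> swap_lat a b (rotv z).
Proof.
by move=> [m [n ->]]; exists n, m; rewrite rotvD !rotvZ !rotv_vec2 addrC.
Qed.

Lemma swap_lat_cyclic a b : cyclic_lattice (swap_lat a b).
Proof.
apply/seteqP; split=> [_ [z Gz <-]|z Gz]; first exact: swap_lat_rotv.
by exists (rotv z); [exact: swap_lat_rotv|exact: rotvK].
Qed.

Lemma det_mx22 (F : comRingType) (A : 'M[F]_2) :
  \det A = A 0 0 * A 1 1 - A 0 1 * A 1 0.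
Proof.
rewrite (expand_det_row _ 0) sum_ord2 /cofactor !det_mx11 !mxE /= expr0 expr1.
by rewrite mul1r mulN1r mulrN; congr (_ * A _ _ - _ * A _ _); apply: val_inj.
Qed.

Lemma swap_mx_free (K : realType) a b : `|b| < a ->
  row_free (toK K (\matrix_(i < 2, j < 2) (if i == j then a else b))).
Proof.
move=> ba; rewrite row_free_unit unitmxE det_mx22 !mxE /= unitfE -!intrM -intrB.
rewrite intr_eq0 subr_eq0; apply/eqP => e; have := normr_ge0 b; nia.
Qed.

(** The generators (a, b) and (b, a) have the same minimal norm, so they bound the second minimum
    and already span the lattice. *)
Lemma swap_lat_C2_WR' (K : realType) (R : K) a b : 0 < R -> reduced a b ->
  (a ^+ 2 + b ^+ 2)%:~R <= R ^+ 2 -> C2_WR' R (swap_lat a b).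
Proof.
move=> R0 rab NR; have [ba _] := rab.
have Sx := swap_lat_min_vector K rab.
pose M : 'M[int]_2 := \matrix_(i, j) (if i == j then a else b).
have rM i : row i M = vec2 a b \/ row i M = vec2 b a.
  case: i => -[|[|//]] hi; [left|right]; apply: rv2P; by rewrite !mxE.
have iM : indep_in K (swap_lat a b) M.
  split; last exact: swap_mx_free.
  by move=> i; case: (rM i) => ->; [apply: lat_l|apply: lat_r].
split.
- split; [exact: lat_sublattice|by exists M|exact: swap_lat_cyclic].
- apply: ge_inf; first by exists 0 => r [].
  split; first exact: ltW.
  exists M; split=> // i; rewrite enorm_le_real; last exact: ltW.
  by case: (rM i) => ->; rewrite nrm2_vec2 ?[b ^+ 2 + _]addrC.
- have Sy : min_vectors K (swap_lat a b) (vec2 b a).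
    by apply/(min_vectors_eq _ Sx); rewrite !nrm2_vec2 addrC; split=> //; apply: lat_r.
  apply/seteqP; split; first exact: (lat_sub_Zspan Sx Sy).
  by apply: Zspan_sub; [exact: lat_sublattice|move=> x []].
Qed.

(** * Classification of the cyclic lattices generated by minimal vectors *)

Lemma Zspan_form_eq0 (S : set 'rV[int]_2) (p q : int) :
  (forall x, S x -> p * x 0 0 + q * x 0 1 = 0) ->
  forall x, Zspan S x -> p * x 0 0 + q * x 0 1 = 0.
Proof.
move=> S0 x [n [v [c [Sv ->]]]]; elim/big_ind: _ => [|y z hy hz|i _].
- by rewrite !mxE !mulr0 addr0.
- by rewrite !mxE !mulrDr addrACA hy hz addr0.
- by rewrite !mxE !(mulrCA _ (c i)) -mulrDr S0 // mulr0.
Qed.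

(** A form vanishing on all minimal vectors would vanish on their span [G], against full rank.
    Applied to x1 - x2 and x1 + x2, this gives a minimal vector off each diagonal. *)
Lemma WR'_min_vector_form (K : realType) (G : set 'rV[int]_2) (p q : int) :
  full_rank K G -> WR' K G -> (p != 0) || (q != 0) ->
  exists2 x, min_vectors K G x & p * x 0 0 + q * x 0 1 != 0.
Proof.
move=> rG wG pq; have [z + zn0] := full_rank_form rG pq.
move=> Gz; apply: contrapT => H; move: Gz; rewrite wG => Sz.
move/eqP: zn0; apply; apply: Zspan_form_eq0 Sz => x Sx.
by apply/eqP/negP => /negP h; apply: H; exists x.
Qed.

Lemma C2_WR'_classification (K : realType) (R : K) G : 0 < R -> C2_WR' R G ->
  (exists a : int, [/\ 0 < a, (2 * a ^+ 2)%:~R <= R ^+ 2 & G = diag_lat a]) \/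
  (exists a b, [/\ reduced a b, (a ^+ 2 + b ^+ 2)%:~R <= R ^+ 2 & G = swap_lat a b]).
Proof.
move=> R0 [[subG rG cG] l2 wG].
have Grot z : G z -> G (rotv z) by move=> Gz; rewrite -cG; exists z.
have Srot z : min_vectors K G z -> min_vectors K G (rotv z).
  move=> Sz; apply/(min_vectors_eq _ Sz).
  by rewrite nrm2_rotv; split=> //; apply: Grot; case: Sz.
have SN z : min_vectors K G z -> min_vectors K G (- z).
  move=> Sz; apply/(min_vectors_eq _ Sz).
  by rewrite nrm2N; split=> //; apply: sublatticeN => //; case: Sz.
have SR x : min_vectors K G x -> (nrm2 x)%:~R <= R ^+ 2.
  move=> Sx; rewrite -enorm_le_real; last exact: ltW.
  apply: le_trans l2; apply: lb_le_inf.
    (* The infimum dominates a lower bound only if the set of radii is nonempty; the sum of the row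
       norms is one such radius. *)
    case: rG => M iM; exists (\sum_i enorm (toK K (row i M))).
    split; first by apply: sumr_ge0 => i _; apply: sqrtr_ge0.
    exists M; split=> // i; rewrite (bigD1 i) //= lerDl.
    by apply: sumr_ge0 => j _; apply: sqrtr_ge0.
  move=> r [_ [M [[GM fM] Mr]]]; apply: le_trans (Mr 0).
  by rewrite enorm_le; apply: (min_vectors_le Sx (GM 0)); apply: (indep_row_neq0 (K := K)).
have [[x [Sx xd]]|nd] := pselect (exists x, min_vectors K G x /\ `|x 0 0| != `|x 0 1|).
  right.
  have {x Sx xd}[x [Sx xd]] : exists x, min_vectors K G x /\ `|x 0 1| < x 0 0.
    have [y [Sy yd]] : exists x, min_vectors K G x /\ `|x 0 1| < `|x 0 0|.
      case: (ltrgtP `|x 0 1| `|x 0 0|) xd => // h _; [by exists x|exists (rotv x)].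
      by rewrite rotv0 rotv1; split=> //; apply: Srot.
    case: (lerP 0 (y 0 0)) => y0; [exists y|exists (- y)].
      by split=> //; rewrite -[ltRHS](ger0_norm y0).
    by split; [exact: SN|rewrite !mxE normrN -ltr0_norm].
  have {x Sx xd}[a [b [Sx ba]]] :
      exists a b, min_vectors K G (vec2 a b) /\ `|b| < a.
    exists (x 0 0), (x 0 1); rewrite (_ : vec2 _ _ = x) //.
    by apply: rv2P; rewrite vec2E.
  have rab : reduced a b.
    have [Gx _] := Sx; split=> //.
    have Gy : G (vec2 b a) by rewrite -rotv_vec2; apply: Grot.
    have h (c : int) : c != 0 -> forall z, G z -> z 0 0 = c ->
        a ^+ 2 + b ^+ 2 <= nrm2 z.
      move=> c0 z Gz zc; rewrite -nrm2_vec2; apply: (min_vectors_le Sx Gz).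
      by apply: contraNneq c0 => z0; rewrite -zc z0 mxE.
    (* The vectors (a + b, a + b) and (a - b, b - a) are nonzero because |b| < a. Their squared
       norms being at least a^2 + b^2 gives the non-strict form of the 15 degree condition. *)
    have := h (a + b) _ _ (sublatticeD subG Gx Gy).
    have := h (a - b) _ _ (sublatticeB subG Gx Gy).
    rewrite /nrm2 !mxE /= => h1 h2.
    have {}h1 := h1 ltac:(lia) erefl; have {}h2 := h2 ltac:(lia) erefl.
    have a0 : 0 < a by apply: le_lt_trans ba.
    rewrite lt_neqAle; apply/andP; split; last first.
      by case: (lerP 0 b) => b0; clear -h1 h2; lia.
    apply/eqP => e; apply: (mul4_neq_sum_sqr a0 (p := `|b|)).
    by rewrite e -normrX [ `|b ^+ 2|]ger0_norm ?sqr_ge0.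
  exists a, b; split=> //; first by rewrite -nrm2_vec2; apply: SR.
  have subL := lat_sublattice (vec2 a b) (vec2 b a).
  apply/seteqP; split; last first.
    apply: lat_sub => //; first by case: Sx.
    by rewrite -rotv_vec2; apply: Grot; case: Sx.
  rewrite wG; apply: Zspan_sub => // z.
  (* Up to sign, [y] lies in the sector around the positive axis, so it is (a, b) or its negative;
     the remaining minimal vectors reduce to this by [rotv]. *)
  have h1 y : min_vectors K G y -> `|y 0 1| <= `|y 0 0| -> swap_lat a b y.
    move=> Sy yc; case: (lerP 0 (y 0 0)) => y0.
      rewrite (reduced_min_vector subG rab Sx Sy); first exact: lat_l.
      by rewrite -(ger0_norm y0).
    rewrite -(opprK y); apply: sublatticeN => //.
    rewrite (reduced_min_vector subG rab Sx (SN _ Sy)); first exact: lat_l.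
    by rewrite !mxE normrN -ltr0_norm.
  move=> Sz; case: (lerP `|z 0 1| `|z 0 0|) => zc; first exact: h1.
  rewrite -(rotvK z); apply: swap_lat_rotv; apply: h1; first exact: Srot.
  by rewrite rotv0 rotv1 ltW.
(* Now every minimal vector lies on a diagonal. Full rank puts one on each of them, and equality of
   norms forces all their coordinates to be [a] or [- a]. *)
left.
have diag x : min_vectors K G x -> x 0 1 = x 0 0 \/ x 0 1 = - x 0 0.
  move=> Sx; suff : `|x 0 0| = `|x 0 1| by lia.
  by apply/eqP/negP => /negP h; apply: nd; exists x.
have [z Sz zd] := @WR'_min_vector_form _ _ 1 (- 1) rG wG isT.
have [w Sw wd] := @WR'_min_vector_form _ _ 1 1 rG wG isT.
have {zd} zd : z 0 1 = - z 0 0 by case: (diag z Sz) => // e; move: zd; rewrite e; lia.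
have ew : w 0 1 = w 0 0 by case: (diag w Sw) => // e; move: wd; rewrite e; lia.
have w0 : w 0 0 != 0 by move: wd; rewrite ew; lia.
have sq x : min_vectors K G x -> x 0 0 = w 0 0 \/ x 0 0 = - w 0 0.
  move=> Sx; have [_] := (min_vectors_eq x Sw).1 Sx.
  rewrite /nrm2 ew => e.
  have : x 0 0 ^+ 2 = w 0 0 ^+ 2 by case: (diag x Sx) e => ->; rewrite ?sqrrN; lia.
  by move/eqP; rewrite eqf_sqr => /orP[]/eqP; [left|right].
set a := `|w 0 0|.
have sq' x : min_vectors K G x -> x 0 0 = a \/ x 0 0 = - a.
  by move=> /sq; rewrite /a; lia.
have a0 : 0 < a by rewrite normr_gt0.
exists a; split=> //.
  by rewrite (_ : 2 * a ^+ 2 = nrm2 w) ?SR // /nrm2 ew; case: (sq' w Sw) => ->; lia.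
have subL := lat_sublattice (vec2 a a) (vec2 a (- a)).
apply/seteqP; split.
  rewrite wG; apply: Zspan_sub => // x Sx.
  case: (diag x Sx) (sq' x Sx) => e1 [] e0.
  - by rewrite (_ : x = vec2 a a); [exact: lat_l|apply: rv2P; rewrite vec2E ?e1 ?e0].
  - rewrite (_ : x = - vec2 a a); first by apply: sublatticeN => //; exact: lat_l.
    by apply: rv2P; rewrite mxE vec2E ?e1 ?e0.
  - by rewrite (_ : x = vec2 a (- a)); [exact: lat_r|apply: rv2P; rewrite vec2E ?e1 ?e0].
  - rewrite (_ : x = - vec2 a (- a)); first by apply: sublatticeN => //; exact: lat_r.
    by apply: rv2P; rewrite mxE vec2E ?e1 ?e0.
have [Gz _] := Sz; have [Gw _] := Sw.
apply: lat_sub => //.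
  case: (sq' w Sw) => e.
    by rewrite (_ : vec2 a a = w) //; apply: rv2P; rewrite vec2E ?ew.
  rewrite (_ : vec2 a a = - w); first exact: sublatticeN.
  by apply: rv2P; rewrite vec2E mxE ?ew e opprK.
case: (sq' z Sz) => e.
  by rewrite (_ : vec2 a (- a) = z) //; apply: rv2P; rewrite vec2E ?zd ?e.
rewrite (_ : vec2 a (- a) = - z); first exact: sublatticeN.
by apply: rv2P; rewrite vec2E mxE ?zd e ?opprK.
Qed.

(** * Cardinality bounds from explicit lists *)

Lemma card_fset_set_le (T : choiceType) (C : set T) (s : seq T) :
  C `<=` [set` s] -> finite_set C /\ (#|` fset_set C| <= size s)%N.
Proof.
move=> Cs; have fC := sub_finite_set Cs (finite_seq s); split=> //.
apply: leq_trans (size_undup s); rewrite -card_fseq; apply: fsubset_leq_card.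
apply/fsubsetP => x; rewrite in_fset_set // inE => /Cs /=; by rewrite !inE.
Qed.

Lemma card_fset_set_ge (T : choiceType) (C : set T) (s : seq T) :
  finite_set C -> uniq s -> [set` s] `<=` C -> (size s <= #|` fset_set C|)%N.
Proof.
move=> fC us sC; rewrite -(undup_id us) -card_fseq; apply: fsubset_leq_card.
apply/fsubsetP => x; rewrite in_fset_set // !inE => /sC.
exact.
Qed.

Lemma iota1_rcons n : iota 1 n.+1 = iota 1 n ++ [:: n.+1].
Proof. by rewrite -(addn1 n) iotaD add1n addn1. Qed.

(** * Enumeration for the upper bound *)

Section Upper.
Variables (K : realType) (R : K).
Hypothesis R0 : 0 < R.
Notation k := (2 + Num.sqrt 3 : K).

(* The pairs (m, a) stand for the points (a, m) and (a, -m). *)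
Definition upper_rows : seq (nat * nat) :=
  [seq (m, a) | m <- iota 1 (Num.truncn (R / (2 * Num.sqrt k))),
     a <- iota `|Num.ceil (k * m%:R)| ((Num.truncn R).+1 - `|Num.ceil (k * m%:R)|)].

(** The four blocks are the diagonal lattices, then those with b = 0, b > 0 and b < 0. Only a
    covering is wanted, so excess entries are harmless. *)
Definition upper_list : seq (set 'rV[int]_2) :=
  [seq diag_lat a%:Z | a <- iota 1 (Num.truncn (R / Num.sqrt 2))] ++
  [seq swap_lat a%:Z 0 | a <- iota 1 (Num.truncn R)] ++
  [seq swap_lat p.2%:Z p.1%:Z | p <- upper_rows] ++
  [seq swap_lat p.2%:Z (- p.1%:Z) | p <- upper_rows].

Lemma mem_upper_rows (a m : nat) : (0 < m <= a)%N -> (4 * a * m <= a ^ 2 + m ^ 2)%N ->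
  (a ^ 2 + m ^ 2)%:R <= R ^+ 2 -> (m, a) \in upper_rows.
Proof.
move=> /andP[m0 ma] am aR; have [h1 h2] := row_bound ma am aR R0.
have aR' : a%:R <= R.
  rewrite -ler_sqr ?nnegrE ?(ltW R0) //; apply: le_trans aR.
  by rewrite -natrX ler_nat leq_addr.
have k0 : 0 <= k * m%:R by rewrite mulr_ge0 // addr_ge0 ?sqrtr_ge0.
apply/allpairsPdep; exists m, a; split=> //.
  rewrite mem_iota m0 add1n ltnS truncn_ge_nat //.
  by rewrite divr_ge0 ?mulr_ge0 ?sqrtr_ge0 ?(ltW R0).
rewrite mem_iota.
have ca : (`|Num.ceil (k * m%:R)| <= a)%N.
  rewrite -lez_nat gez0_abs; first by rewrite ceil_le_int.
  by rewrite ceil_ge0 (lt_le_trans _ k0) // ltrN10.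
have aA : (a <= Num.truncn R)%N by rewrite truncn_ge_nat ?(ltW R0).
by rewrite ca subnKC ?ltnS // (leq_trans ca) // (leq_trans aA).
Qed.

Lemma C2_WR'_sub_upper_list : C2_WR' R `<=` [set` upper_list].
Proof.
move=> G /(C2_WR'_classification R0)[[a [a0 aR ->]]|[a [b [[ba ab] NR ->]]]] /=;
  rewrite !mem_cat.
  case: a a0 aR => // a a0 aR; apply/orP; left; apply: map_f.
  rewrite mem_iota add1n ltnS truncn_ge_nat ?divr_ge0 ?sqrtr_ge0 ?(ltW R0) //.
  rewrite ler_pdivlMr ?sqrtr_gt0 // -ler_sqr ?nnegrE ?mulr_ge0 ?sqrtr_ge0 ?(ltW R0) //.
  rewrite exprMn sqr_sqrtr // mulrC; move: aR; rewrite intrM rmorphXn /=.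
  by move=> aR; rewrite -ltz_nat a0.
have a0 : 0 < a by apply: le_lt_trans ba.
case: a a0 ba ab NR => // a a0 ba ab NR.
have [b0|bn0] := eqVneq b 0.
  apply/orP; right; apply/orP; left; rewrite b0; apply: map_f.
  rewrite mem_iota add1n ltnS -ltz_nat a0 truncn_ge_nat ?(ltW R0) //=.
  rewrite -ler_sqr ?nnegrE ?(ltW R0) //; move: NR.
  by rewrite b0 expr0n addr0 rmorphXn.
have mem : (`|b|%N, a) \in upper_rows.
  apply: mem_upper_rows; [lia| |].
    by rewrite -lez_nat; move: ab; lia.
  suff -> : (a ^ 2 + `|b| ^ 2)%:R = (a%:Z ^+ 2 + b ^+ 2)%:~R :> K by [].
  rewrite natrD !natrX intrD !rmorphXn /=; congr (_ + _).
  by rewrite natr_absz -rmorphXn -normrX ger0_norm ?sqr_ge0 // rmorphXn.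
case: (lerP 0 b) => b0; do 2 (apply/orP; right); apply/orP; [left|right].
  by apply/mapP; exists (`|b|%N, a) => //=; rewrite gez0_abs.
by apply/mapP; exists (`|b|%N, a) => //=; rewrite ltz0_abs // opprK.
Qed.

(** Row m has at most R + 1 - k m entries; summing over m up to B gives B (R + 1) - k B (B + 1) / 2,
    stated here doubled. *)
Lemma size_upper_rows : (size upper_rows)%:R * 2 <=
  2 * (Num.truncn (R / (2 * Num.sqrt k)))%:R * (R + 1)
  - k * (Num.truncn (R / (2 * Num.sqrt k)))%:R
      * ((Num.truncn (R / (2 * Num.sqrt k)))%:R + 1).
Proof.
rewrite /upper_rows size_allpairs_dep; set B := Num.truncn (R / _).
have /andP[t1 t2] := sqrt3_bounds K.
have /andP[s1 s2] := two_cos15_bounds K; have es := sqr_two_cos15 K.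
have BR : B%:R * (2 * Num.sqrt k) <= R.
  rewrite -ler_pdivlMr; last by lra.
  by rewrite /B truncn_le divr_ge0 ?mulr_ge0 ?sqrtr_ge0 ?(ltW R0).
(* This uses k = s^2 <= 2 s. It keeps the row bound R + 1 - k m positive, so the bound survives when
   the truncated subtraction is 0. *)
have kB : k * B%:R <= R.
  by apply: le_trans BR; rewrite mulrC ler_wpM2l //; lra.
have : (B <= B)%N by [].
elim: {-2}B => [|n IH] nB; first by rewrite /= mulr0n; lra.
rewrite iota1_rcons map_cat sumn_cat /= addn0 natrD mulrDl.
have := IH (ltnW nB); rewrite size_iota.
set c := absz _.
have kn : k * n.+1%:R <= R.
  by apply: le_trans kB; rewrite ler_wpM2l ?ler_nat //; lra.
have hc : k * n.+1%:R <= c%:R.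
  apply: (le_trans (ceil_ge _)); rewrite /c natr_absz ger0_norm //.
  by rewrite ceil_ge0 (lt_le_trans (ltrN10 _)) // mulr_ge0 //; lra.
have : ((Num.truncn R).+1 - c)%:R <= R + 1 - k * n.+1%:R.
  case: (leqP c (Num.truncn R).+1) => h; last first.
    by rewrite (eqP (ltnW h : _ - _ == 0)%N); lra.
  rewrite natrB // -natr1 lerB // lerD2r truncn_le ltW //.
rewrite -natr1; set x := n%:R.
move: (sumn _) => S; nra.
Qed.

Lemma size_upper_list : (size upper_list)%:R <= c3 K * R ^+ 2 + c4 K * R.
Proof.
rewrite /upper_list !size_cat !size_map !size_iota !natrD.
have /andP[s1 s2] := two_cos15_bounds K; have es := sqr_two_cos15 K.
have q0 : 0 < R / (2 * Num.sqrt k) by rewrite divr_gt0 //; lra.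
have r2 : 1 <= Num.sqrt 2 :> K.
  have e2 : Num.sqrt 2 ^+ 2 = 2 :> K by rewrite sqr_sqrtr.
  by have := sqrtr_ge0 (2 : K); nra.
have A1 : (Num.truncn (R / Num.sqrt 2))%:R <= 1 / Num.sqrt 2 * R.
  by rewrite mul1r [leRHS]mulrC truncn_le divr_ge0 ?sqrtr_ge0 ?(ltW R0).
have A2 : (Num.truncn R)%:R <= R by rewrite truncn_le ltW.
case: (lerP 1 R) => R1.
  have B0 : (Num.truncn (R / (2 * Num.sqrt k)))%:R <= R / (2 * Num.sqrt k).
    by rewrite truncn_le ltW.
  have := upper_count_bound R1 (ler0n _ _) B0; have := size_upper_rows.
  by rewrite /c3 /c4; lra.
(* [upper_count_bound] requires [1 <= R]; for smaller [R] all four blocks are empty. *)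
have t0 (x : K) : x < 1 -> Num.truncn x = 0%N.
  by move=> x1; apply/eqP; rewrite -leqn0 truncn_le_nat.
have -> : size upper_rows = 0%N.
  by rewrite /upper_rows (t0 (R / (2 * _))) // ltr_pdivrMr; lra.
rewrite (t0 (R / _)); last by rewrite ltr_pdivrMr; lra.
rewrite (t0 R) // !addr0.
have c30 : 0 <= c3 K by rewrite subr_ge0 ler_pdivlMr; lra.
have c40 : 0 <= c4 K by rewrite addr_ge0 // divr_ge0 ?sqrtr_ge0.
by rewrite addr_ge0 ?mulr_ge0 ?sqr_ge0 ?(ltW R0).
Qed.

(** * Enumeration for the lower bound *)

(** Shifting [j] makes b run through the integers with |b| <= floor (a / 4). The slope 1/4 is below
    tan 15 degrees, and 17/16 times (9/10)^2 is below 1, which keeps the points in the disc. *)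
Definition lower_list : seq (set 'rV[int]_2) :=
  [seq swap_lat a%:Z (j%:Z - (a %/ 4)%:Z) |
    a <- iota 1 (Num.truncn (9 * R / 10)), j <- iota 0 (2 * (a %/ 4)).+1].

Lemma lower_reduced (a j : nat) : (0 < a)%N -> (j <= 2 * (a %/ 4))%N ->
  reduced a%:Z (j%:Z - (a %/ 4)%:Z).
Proof.
move=> a0 ja; set b := _ - _.
have h : 4 * `|b| <= a%:Z by rewrite /b; lia.
clearbody b; split; first by lia.
have [->|b0] := eqVneq b 0; first by rewrite normr0 mulr0 ltr_wpDr //; nia.
have : 0 < b ^+ 2 by rewrite exprn_even_gt0.
nia.
Qed.

Lemma lower_list_sub : [set` lower_list] `<=` C2_WR' R.
Proof.
move=> _ /= /allpairsPdep[a [j [+ + ->]]]; rewrite !mem_iota !add1n add0n !ltnS.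
have r0 : 0 <= 9 * R / 10 by rewrite divr_ge0 ?mulr_ge0 ?(ltW R0).
move=> /andP[a0]; rewrite truncn_ge_nat // => aR /= ja.
apply: swap_lat_C2_WR' => //; first exact: lower_reduced.
have h : 16 * (j%:Z - (a %/ 4)%:Z) ^+ 2 <= a%:Z ^+ 2.
  have : `|j%:Z - (a %/ 4)%:Z| * 4 <= a%:Z by lia.
  by set b := _ - _; clearbody b; nia.
set b := _ - _ in h *; have {h} : (a%:Z ^+ 2 + b ^+ 2) * 16 <= 17 * (a%:Z * a%:Z).
  by move: (a%:Z) b h => x b; lia.
rewrite -(ler_int K) !intrM => h.
have : (a%:R : K) * a%:R <= (9 * R / 10) * (9 * R / 10) by rewrite ler_pM.
have : 0 <= R ^+ 2 by rewrite sqr_ge0.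
by rewrite expr2; lra.
Qed.

Lemma lower_list_uniq : uniq lower_list.
Proof.
apply: allpairs_uniq_dep => [|a _|]; try exact: iota_uniq.
move=> _ _ /allpairsPdep[a [j [+ + ->]]] /allpairsPdep[a' [j' [+ + ->]]] /=.
rewrite !mem_iota !add1n !add0n !ltnS => /andP[a0 _] /= ja /andP[a'0 _] ja'.
move=> /(swap_lat_inj K (lower_reduced a0 ja) (lower_reduced a'0 ja'))[[ea]].
by rewrite -ea => /addIr[->].
Qed.

Lemma size_lower_list : c1 K * R ^+ 2 - c2 K * R <= (size lower_list)%:R.
Proof.
apply: lower_count_bound => //; first exact: truncnS_gt.
rewrite /lower_list size_allpairs_dep; move: (Num.truncn _) => A.
under eq_map do rewrite size_iota.
(* Row a has 2 floor (a / 4) + 1 entries, and four times this is at least 2 a - 2, the increment of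
   A^2 - A at A = a. *)
elim: A => // n IH; rewrite iota1_rcons map_cat sumn_cat /= addn0.
move: (sumn _) IH => S; have := leq_trunc_div n.+1 4; have := ltn_ceil n.+1 (isT : 0 < 4)%N.
rewrite !expnS expn0; nia.
Qed.

End Upper.

Theorem theorem1p3 (K : realType) (R : K) (hR : 0 < R) :
  finite_set (C2_WR' R) /\
  c1 K * R ^+ 2 - c2 K * R <= (#|` fset_set (C2_WR' R)|)%:R
                           <= c3 K * R ^+ 2 + c4 K * R.
Proof.
have [fC leC] := card_fset_set_le (C2_WR'_sub_upper_list hR).
split=> //; apply/andP; split.
  apply: le_trans (size_lower_list hR) _; rewrite ler_nat.
  by apply: card_fset_set_ge => //; [exact: lower_list_uniq|exact: lower_list_sub].
by apply: le_trans (size_upper_list hR); rewrite ler_nat.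
Qed.
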